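(* Let $(p,q,r)\in P\cup P_1\cup P_2$ and $\widetilde\theta_0\ne\widetilde\theta_1$. Assume that for $(p,q,r)\in P\cup P_1$ $$\widetilde I_1=\int_T\left|\frac{w(t)}{w_0(t)}\right|^{\frac{qp}{p-q}}\widetilde k^{\frac p{p-q}}(t)\,d\mu(t)<\infty,\qquad \widetilde I_{j+1}=\int_T\frac{|w(t)|^{\frac{qr}{p-q}}}{|w_0(t)|^{\frac{pr}{p-q}}}|w_j(t)|^r\widetilde k^{\frac r{p-q}}(t)\,d\mu(t)<\infty,\quad j=1,\ldots,n,$$ and for $(p,q,r)\in P_2$ $$\widetilde I_1=\int_T|w_0(t)|^p\left(\frac{(|w(t)|^p-|w_0(t)|^p)_+}{\sum_{k=1}^n|w_k(t)|^r}\right)^{\frac p{r-p}}d\mu(t)<\infty,\qquad \widetilde I_{j+1}=\int_T|w_j(t)|^r\left(\frac{(|w(t)|^p-|w_0(t)|^p)_+}{\sum_{k=1}^n|w_k(t)|^r}\right)^{\frac r{r-p}}d\mu(t)<\infty,\quad j=1,\ldots,n.$$ Moreover, assume that $\widetilde I_2=\ldots=\widetilde I_{n+1}$. Then for all $x\ne0$ such that $w_0x\in L_p(T,\mu)$ and $w_jx\in L_r(T,\mu)$, $j=1,\ldots,n$, the inequality $$\|wx\|_{L_q(T,\mu)}\le\widetilde C\,\|w_0x\|_{L_p(T,\mu)}^{\widetilde\gamma}\left(\max_{1\le j\le n}\|w_jx\|_{L_r(T,\mu)}\right)^{1-\widetilde\gamma}$$ holds and is sharp (the constant cannot be replaced by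 a smaller one), where $$\widetilde C=\widetilde I_1^{-\widetilde\gamma/p}\,\widetilde I_2^{-(1-\widetilde\gamma)/r}\,(\widetilde I_1+n\widetilde I_2)^{1/q}.$$
   Context: $a_+=\max\{a,0\}$. Parameter sets (all exponents finite): $P=\{(p,q,r):1\le q<p,r<\infty\}$, $P_1=\{(p,q,r):1\le q=r<p<\infty\}$, $P_2=\{(p,q,r):1\le q=p<r<\infty\}$. $T$ is a cone in a linear space, with measure $\mu$ homogeneous of degree $d$ ($\mu(cA)=c^d\mu(A)$, $c>0$). $w,w_0,w_1,\ldots,w_n$ are measurable functions on $T$ such that $|w|$, $|w_0|$ are homogeneous of degrees $\theta,\theta_0$ respectively (i.e. $|w(ct)|=c^\theta|w(t)|$, $c>0$, etc.), all $|w_j|$, $j=1,\ldots,n$, are homogeneous of degree $\theta_1$, and $w(t),w_0(t)\ne0$, $\sum_{j=1}^n|w_j(t)|\ne0$ for almost all $t\in T$. Put $$\widetilde\theta=\theta+d/q,\quad\widetilde\theta_0=\theta_0+d/p,\quad\widetilde\theta_1=\theta_1+d/r,\quad\widetilde\gamma=\frac{\widetilde\theta_1-\widetilde\theta}{\widetilde\theta_1-\widetilde\theta_0}.$$ For $(p,q,r)\in P$, $\widetilde k(t)\in[0,1)$ is defined by $$\frac{\widetilde k^{\frac1{p-q}}(t)}{(1-\widetilde k(t))^{\frac1{r-q}}}=\left|\frac{w_0(t)}{w(t)}\right|^{\frac p{p-q}}\left(\sum_{j=1}^n\left|\frac{w_j(t)}{w(t)}\right|^r\right)^{-\frac1{r-q}};$$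 for $(p,q,r)\in P_1$, $\widetilde k(t)=\bigl(1-|w(t)|^{-q}\sum_{j=1}^n|w_j(t)|^q\bigr)_+$. Functions are real- or complex-valued. *)

(* Defs.v *)
From HB Require Import structures.
From mathcomp Require Import all_boot all_order all_algebra.
From mathcomp Require Import complex.
From mathcomp Require Import all_classical all_reals all_analysis.

Set Implicit Arguments.
Unset Strict Implicit.
Unset Printing Implicit Defensive.

Import Order.TTheory GRing.Theory Num.Theory.
Import numFieldNormedType.Exports.

Local Open Scope classical_set_scope.
Local Open Scope ring_scope.

(* Functions are real-valued or complex-valued; statements quantify over
   [K : scalar_kind] and take values in [scalar_field R K]. *)
Variant scalar_kind := RealScalars | ComplexScalars.

Definition scalar_field (R : realType) (K : scalar_kind) : fieldType :=
  match K with
  | RealScalars => R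
  | ComplexScalars => R[i]
  end.

Definition modulus (R : realType) (K : scalar_kind) : scalar_field R K -> R :=
  match K return scalar_field R K -> R with
  | RealScalars => fun a => `|a|
  | ComplexScalars => fun z => ComplexField.Normc.normc z
  end.

(* The library puts no sigma-algebra on [R[i]]; a complex-valued function is
   measurable when its real and imaginary parts are. *)
Definition scalar_measurable (R : realType) (K : scalar_kind)
    (disp : measure_display) (T : measurableType disp) :
    (T -> scalar_field R K) -> Prop :=
  match K return (T -> scalar_field R K) -> Prop with
  | RealScalars => fun f => measurable_fun [set: T] f
  | ComplexScalars => fun f =>
      measurable_fun [set: T] (fun t => complex.Re (f t)) /\
      measurable_fun [set: T] (fun t => complex.Im (f t))
  end.

Section exponents.
Context {R : realType}.
Implicit Types p q r : R.

Definition in_P p q r := [/\ 1 <= q, q < p & q < r].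
Definition in_P1 p q r := [/\ 1 <= q, q = r & r < p].
Definition in_P2 p q r := [/\ 1 <= q, q = p & p < r].

End exponents.

(* A cone in the linear space [V] that carries a sigma-algebra is given as a
   measurable type [T] together with its inclusion [iota : T -> V]; the point
   [c t] of the cone is then the [s : T] such that [iota s = c *: iota t]. *)
Section cones.
Context {R : realType} {V : lmodType R}.
Context {disp : measure_display} {T : measurableType disp}.
Variable iota : T -> V.

Definition is_cone : Prop :=
  injective iota /\
  forall (c : R) (t : T), 0 < c -> exists s : T, iota s = c *: iota t.

Definition dilate (c : R) (A : set T) : set T :=
  [set s | exists2 t, A t & iota s = c *: iota t].

Definition homogeneous_measure (d : R) (mu : {measure set T -> \bar R}) : Prop :=
  forall (c : R) (A : set T), 0 < c -> measurable A ->
    measurable (dilate c A) /\ mu (dilate c A) = ((c `^ d)%:E * mu A)%E.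

Definition homogeneous (theta : R) (f : T -> R) : Prop :=
  forall (c : R) (s t : T), 0 < c -> iota s = c *: iota t ->
    f s = c `^ theta * f t.

End cones.

Section carlson.
Context {R : realType} {K : scalar_kind}.
Context {disp : measure_display} {T : measurableType disp}.
Variable mu : {measure set T -> \bar R}.
Implicit Types (p q r : R) (f x : T -> scalar_field R K).

Definition Lp_norm p f : \bar R :=
  Lnorm mu p%:E (fun t => (modulus (f t))%:E).

Definition in_Lp p f : Prop := scalar_measurable f /\ (Lp_norm p f < +oo)%E.

Section weights.
Variables (p q r : R) (n : nat).
Variables (w w0 : T -> scalar_field R K) (w_ : 'I_n -> T -> scalar_field R K).

(* For [q < p] and [q < r], the left-hand side of the equation is an increasing
   bijection from [0, 1[ onto [0, +oo[ as a function of [k], and the right-hand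
   side is nonnegative, so [k] exists and is unique; the default value [0] of
   [xget] is never used. *)
Definition ktilde_P (t : T) : R :=
  xget 0 [set k : R | (0 <= k < 1) /\
    k `^ (p - q)^-1 / (1 - k) `^ (r - q)^-1 =
    (modulus (w0 t) / modulus (w t)) `^ (p / (p - q)) *
    (\sum_(j < n) (modulus (w_ j t) / modulus (w t)) `^ r) `^ (- (r - q)^-1)].

Definition ktilde_P1 (t : T) : R :=
  Num.max (1 - modulus (w t) `^ (- q) * \sum_(j < n) modulus (w_ j t) `^ q) 0.

(* Used on P and P1 only, where [q < r] singles out P. *)
Definition ktilde (t : T) : R := if q < r then ktilde_P t else ktilde_P1 t.

Definition ratio_P2 (t : T) : R :=
  Num.max (modulus (w t) `^ p - modulus (w0 t) `^ p) 0 /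
  \sum_(j < n) modulus (w_ j t) `^ r.

(* In [Itilde_1] and [Itilde_succ], [q < p] holds exactly on P and P1, [q = p] on P2. *)
Definition Itilde_1 : \bar R :=
  if q < p then
    (\int[mu]_t ((modulus (w t) / modulus (w0 t)) `^ (q * p / (p - q)) *
                 ktilde t `^ (p / (p - q)))%:E)%E
  else
    (\int[mu]_t (modulus (w0 t) `^ p * ratio_P2 t `^ (p / (r - p)))%:E)%E.

Definition Itilde_succ (j : 'I_n) : \bar R :=
  if q < p then
    (\int[mu]_t (modulus (w t) `^ (q * r / (p - q)) /
                 modulus (w0 t) `^ (p * r / (p - q)) *
                 modulus (w_ j t) `^ r * ktilde t `^ (r / (p - q)))%:E)%E
  else
    (\int[mu]_t (modulus (w_ j t) `^ r * ratio_P2 t `^ (r / (r - p)))%:E)%E.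

(* "x <> 0" is meant in the sense of classes modulo null sets. *)
Definition admissible x : Prop :=
  [/\ scalar_measurable x,
      ~ {ae mu, forall t, x t = 0},
      in_Lp p (fun t => w0 t * x t) &
      forall j : 'I_n, in_Lp r (fun t => w_ j t * x t)].

Definition carlson_inequality (gamma C : R) : Prop :=
  forall x, admissible x ->
    (Lp_norm q (fun t => w t * x t)%R <=
     C%:E * (Lp_norm p (fun t => w0 t * x t)%R `^ gamma *
             (\big[maxe/0]_(j < n) Lp_norm r (fun t => w_ j t * x t)%R)
               `^ (1 - gamma)))%E.

End weights.
End carlson.

(* Main.v *)
(** Write [a], [a0], [b_j] for the moduli of the weights and [u] for that of [x].
    The integrands of [Itilde_1] and [Itilde_succ] are [(a0 v)^p] and
    [(b_j v)^r] for an explicit [v >= 0] that maximizes pointwise, over [u >= 0],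
      [a^q u^q - (q/p) a0^p u^p - (q/r) sum_j b_j^r u^r].
    Integrating the resulting bound on [a^q u^q] gives
      [int (a u)^q <= (q/p) int (a0 u)^p + (1 - q/p) I_1
                      + sum_j ((q/r) int (b_j u)^r + (1 - q/r) I_2)].
    Replacing [u] by [t |-> s * u(c t)] multiplies the three norms by
    [s c^(-ttheta)], [s c^(-ttheta0)], [s c^(-ttheta1)]; since
    [ttheta0 <> ttheta1], one can choose [s] and [c] so that the right-hand side
    becomes at most [I_1 + n I_2], and scaling back yields the inequality.
    Equality holds for [x = v]. *)

Require Import Defs.
From HB Require Import structures.
From mathcomp Require Import all_boot all_order all_algebra.
From mathcomp Require Import complex.
From mathcomp Require Import all_classical all_reals all_analysis.
From mathcomp Require Import measurable_realfun ring.

Set Implicit Arguments.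
Unset Strict Implicit.
Unset Printing Implicit Defensive.

Import Order.TTheory GRing.Theory Num.Theory.
Import numFieldNormedType.Exports.

Local Open Scope classical_set_scope.
Local Open Scope ring_scope.

(** * Real powers and Young's inequality *)

Section powR_facts.
Context {R : realType}.
Implicit Types p q u v x y : R.

Lemma powRK x p : 0 <= x -> p != 0 -> (x `^ p) `^ p^-1 = x.
Proof. by move=> x0 p0; rewrite -powRrM divff// powRr1. Qed.

Lemma powRVK x p : 0 <= x -> p != 0 -> (x `^ p^-1) `^ p = x.
Proof. by move=> x0 p0; rewrite -powRrM mulVf// powRr1. Qed.

Lemma powR_inv x p : 0 <= x -> (x^-1) `^ p = (x `^ p)^-1.
Proof. by move=> x0; rewrite -powR_inv1// -powRrM mulN1r powRN. Qed.

Lemma powR_div x y p : 0 <= x -> 0 <= y -> (x / y) `^ p = x `^ p / y `^ p.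
Proof. by move=> x0 y0; rewrite powRM ?invr_ge0// powR_inv. Qed.

(** Young's inequality with the conjugate exponents [p / q] and [p / (p - q)]. At [q = p] the second
    exponent degenerates, but both sides are then u^q. *)
Lemma young_powR p q u v : 0 < q -> q <= p -> 0 <= u -> 0 <= v ->
  u `^ q * v `^ (p - q) <= q / p * u `^ p + (1 - q / p) * v `^ p.
Proof.
move=> q0; rewrite le_eqVlt => /predU1P[<-|qp] u0 v0.
  by rewrite subrr powRr0 mulr1 divff ?gt_eqF// subrr mul0r addr0 mul1r.
have p0 : 0 < p by exact: lt_trans qp.
have pq0 : 0 < p - q by rewrite subr_gt0.
have := @conjugate_powR R (u `^ q) (v `^ (p - q)) (p / q) (p / (p - q))
  (powR_ge0 _ _) (powR_ge0 _ _) (divr_gt0 p0 q0) (divr_gt0 p0 pq0).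
have e1 : q * (p / q) = p by field; rewrite gt_eqF.
have e2 : (p - q) * (p / (p - q)) = p by field; rewrite gt_eqF.
rewrite -!powRrM e1 e2 !invf_div => /(_ _)/le_trans; apply.
  by field; rewrite gt_eqF.
rewrite le_eqVlt; apply/orP; left; apply/eqP.
by field; rewrite gt_eqF.
Qed.

(** The absolute value matters: [powR] is constantly 1 on negative bases, so without it continuity
    fails at 0. The intermediate value theorem in [kappa_exists] relies on this continuity. *)
Lemma continuous_norm_powR p : 0 < p -> continuous (fun x : R => `|x| `^ p).
Proof.
move=> p0 x; have [->|x0] := eqVneq x 0.
  apply/cvgrPdist_lt => /= e e0.
  have d0 : 0 < e `^ p^-1 by exact: powR_gt0.
  rewrite normr0 powR0 ?gt_eqF//.
  have := @nbhs0_lt R R _ d0; apply: filterS => y yd.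
  rewrite sub0r normrN ger0_norm ?powR_ge0//.
  rewrite -[ltRHS](@powRVK e p) ?(ltW e0) ?gt_eqF//.
  by rewrite gt0_ltr_powR ?nnegrE ?powR_ge0.
apply: (@continuous_comp _ _ _ (fun x : R => `|x|) (fun y => y `^ p)).
  exact: norm_continuous.
apply: differentiable_continuous; apply/derivable1_diffP.
by apply: derivable_powR; rewrite in_itv/= andbT normr_gt0.
Qed.

End powR_facts.

(** * Change of variables under dilations of the cone *)

Section dilations.
Context {R : realType} {V : lmodType R}.
Context {disp : measure_display} {T : measurableType disp}.
Variables (iota : T -> V) (d : R) (mu : {measure set T -> \bar R}).
Hypothesis coneT : is_cone iota.
Hypothesis mu_hom : homogeneous_measure iota d mu.
Variables (c : R) (dil : T -> T).
Hypothesis c0 : 0 < c.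
Hypothesis dilE : forall t, iota (dil t) = c *: iota t.

(** Injectivity of [iota] makes [dil] the only map realizing multiplication by [c]; its preimages
    are thus dilates by the inverse factor, to which [mu_hom] applies. *)
Lemma preimage_dilation (A : set T) : dil @^-1` A = dilate iota c^-1 A.
Proof.
have cN0 : c != 0 by rewrite gt_eqF.
apply/seteqP; split=> [s As|s [t At est]].
  by exists (dil s) => //; rewrite dilE scalerA mulVf// scale1r.
rewrite /preimage/= (_ : dil s = t)//; apply: coneT.1.
by rewrite dilE est scalerA divff// scale1r.
Qed.

Lemma measurable_dilation : measurable_fun setT dil.
Proof.
move=> _ A mA; rewrite setTI preimage_dilation.
by case: (@mu_hom c^-1 A); rewrite ?invr_gt0.
Qed.

(** By [preimage_dilation] and homogeneity, the pushforward of [mu] under [dil] is c^(-d) times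
    [mu]. *)
Lemma ge0_integral_dilation (f : T -> \bar R) : measurable_fun [set: T] f ->
  (forall t, 0 <= f t)%E ->
  (\int[mu]_t f (dil t) = (c `^ (- d))%:E * \int[mu]_t f t)%E.
Proof.
move=> mf f0.
have k0 : 0 <= c `^ (- d) by exact: powR_ge0.
have := ge0_integral_pushforward measurable_dilation mu measurableT mf.
rewrite preimage_setT => /(_ (fun t _ => f0 t)) /= <-.
rewrite -(@ge0_integral_mscale _ _ _ mu setT measurableT (NngNum k0) f mf)//.
apply: eq_measure_integral => [|mdil A mA _]; first exact: measurable_dilation.
rewrite /= /mscale/= /pushforward preimage_dilation.
have [|//|_ ->] := @mu_hom c^-1 A; first by rewrite invr_gt0.
by congr (_%:E * _)%E; rewrite powR_inv ?powRN// ltW.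
Qed.

(** Two powers of [c] leave the integral: one because f(t) = c^(-theta) f(dil t), and c^(-d) from
    the change of variables. Collected into a single p-th power they produce the exponent
    [theta + d / p]. *)
Lemma ge0_integral_rescale (theta p s : R) (f u : T -> R) :
  0 < p -> 0 <= s -> homogeneous iota theta f ->
  measurable_fun setT f -> measurable_fun setT u ->
  (forall t, 0 <= f t) -> (forall t, 0 <= u t) ->
  (\int[mu]_t ((f t * (s * u (dil t))) `^ p)%:E =
   ((s * c `^ (- (theta + d / p))) `^ p)%:E * \int[mu]_t ((f t * u t) `^ p)%:E)%E.
Proof.
move=> p0 s0 fh mf mu_ f0 u0.
have cge0 := ltW c0.
have cp x : c `^ x != 0 by rewrite gt_eqF// powR_gt0.
transitivity (\int[mu]_t ((((s * c `^ (- theta)) `^ p)%:E *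
    ((f (dil t) * u (dil t)) `^ p)%:E)))%E.
  apply: eq_integral => t _; rewrite -EFinM; congr EFin.
  rewrite -powRM ?mulr_ge0 ?powR_ge0//; congr (_ `^ _).
  by rewrite (fh _ _ _ c0 (dilE t)) powRN; field.
have mfu : measurable_fun [set: T] (fun t => ((f t * u t) `^ p)%:E).
  apply/measurable_EFinP/(measurableT_comp (measurable_powR _)).
  exact: measurable_funM.
pose g t := ((f t * u t) `^ p)%:E.
rewrite (@ge0_integralZl_EFin _ _ _ mu setT measurableT (g \o dil)); last 3 first.
- by move=> t _; rewrite /g/= lee_fin powR_ge0.
- exact: measurableT_comp mfu measurable_dilation.
- exact: powR_ge0.
rewrite (@ge0_integral_dilation (fun t => ((f t * u t) `^ p)%:E))//; last first.
  by move=> t; rewrite lee_fin powR_ge0.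
have -> : (s * c `^ (- (theta + d / p))) `^ p =
    (s * c `^ (- theta)) `^ p * c `^ (- d); last first.
  by rewrite [in RHS]EFinM -[RHS]muleA.
rewrite !powRM ?powR_ge0// -mulrA -!powRrM -powRD ?(gt_eqF c0) ?implybT//.
by congr (_ * c `^ _); field; rewrite gt_eqF.
Qed.

End dilations.

(** * Integration of the pointwise Young bound *)

Section integrated_young.
Context {R : realType} {disp : measure_display} {T : measurableType disp}.
Variable mu : {measure set T -> \bar R}.
Variables (p q r : R) (n : nat).
Variables (a a0 : T -> R) (b : 'I_n -> T -> R) (u v : T -> R).
Hypotheses (q0 : 0 < q) (qp : q <= p) (qr : q <= r).
Hypotheses (ma : measurable_fun setT a) (ma0 : measurable_fun setT a0).
Hypothesis mb : forall j, measurable_fun setT (b j).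
Hypotheses (mu_ : measurable_fun setT u) (mv : measurable_fun setT v).
Hypotheses (a_ge0 : forall t, 0 <= a t) (a0_ge0 : forall t, 0 <= a0 t).
Hypothesis b_ge0 : forall j t, 0 <= b j t.
Hypotheses (u_ge0 : forall t, 0 <= u t) (v_ge0 : forall t, 0 <= v t).
Hypothesis domin : {ae mu, forall t, a t `^ q <=
  a0 t `^ p * v t `^ (p - q) + \sum_(j < n) b j t `^ r * v t `^ (r - q)}.

Let young_mul s t (f : T -> R) : q <= s -> 0 <= f t ->
  f t `^ s * v t `^ (s - q) * u t `^ q <=
  q / s * (f t * u t) `^ s + (1 - q / s) * (f t * v t) `^ s.
Proof.
move=> qs f0; rewrite !powRM// -mulrA [_ `^ (s - q) * _]mulrC.
rewrite [q / s * _]mulrCA [(1 - _) * _]mulrCA -mulrDr ler_wpM2l ?powR_ge0//.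
exact: young_powR.
Qed.

Let mfun s (f g : T -> R) : measurable_fun setT f -> measurable_fun setT g ->
  measurable_fun [set: T] (fun t => ((f t * g t) `^ s)%:E).
Proof.
move=> mf mg; apply/measurable_EFinP/(measurableT_comp (measurable_powR _)).
exact: measurable_funM.
Qed.

Let ge0_fun s (f g : T -> R) t : (0 <= ((f t * g t) `^ s)%:E)%E.
Proof. by rewrite lee_fin powR_ge0. Qed.

Let ge0_ratio s : q <= s -> 0 <= q / s.
Proof. by move=> qs; rewrite divr_ge0 ?ltW// (lt_le_trans q0). Qed.

Let ge0_1ratio s : q <= s -> 0 <= 1 - q / s.
Proof. by move=> qs; rewrite subr_ge0 ler_pdivrMr ?mul1r// (lt_le_trans q0). Qed.

Let young_term s (f : T -> R) t : \bar R :=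
  ((q / s)%:E * ((f t * u t) `^ s)%:E + (1 - q / s)%:E * ((f t * v t) `^ s)%:E)%E.

Let young_term_ge0 s f t : q <= s -> (0 <= young_term s f t)%E.
Proof.
by move=> qs; rewrite adde_ge0 ?mule_ge0 ?lee_fin ?powR_ge0 ?ge0_ratio ?ge0_1ratio.
Qed.

Let measurable_young_term s f : measurable_fun setT f ->
  measurable_fun [set: T] (young_term s f).
Proof.
by move=> mf; apply: emeasurable_funD; apply: emeasurable_funM => //; exact: mfun.
Qed.

Let integral_young_term s f : q <= s -> measurable_fun setT f ->
  (\int[mu]_t young_term s f t =
   (q / s)%:E * \int[mu]_t ((f t * u t) `^ s)%:E +
   (1 - q / s)%:E * \int[mu]_t ((f t * v t) `^ s)%:E)%E.
Proof.
move=> qs mf; rewrite ge0_integralD//.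
- rewrite !ge0_integralZl_EFin ?ge0_ratio ?ge0_1ratio//; exact: mfun.
- by move=> t _; rewrite mule_ge0 ?lee_fin ?powR_ge0 ?ge0_ratio.
- by apply: emeasurable_funM => //; exact: mfun.
- by move=> t _; rewrite mule_ge0 ?lee_fin ?powR_ge0 ?ge0_1ratio.
- by apply: emeasurable_funM => //; exact: mfun.
Qed.

(** Multiply [domin] by u^q and apply [young_mul] to the [a0] term and to each [b j] term. All
    integrands are nonnegative, so the integrals may be split even when they are infinite. *)
Lemma integral_le_young :
  (\int[mu]_t ((a t * u t) `^ q)%:E <=
   ((q / p)%:E * \int[mu]_t ((a0 t * u t) `^ p)%:E +
    (1 - q / p)%:E * \int[mu]_t ((a0 t * v t) `^ p)%:E) +
   \sum_(j < n) ((q / r)%:E * \int[mu]_t ((b j t * u t) `^ r)%:E +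
    (1 - q / r)%:E * \int[mu]_t ((b j t * v t) `^ r)%:E))%E.
Proof.
have sum_ge0 t : (0 <= \sum_(j < n) young_term r (b j) t)%E.
  by apply: sume_ge0 => j _; exact: young_term_ge0.
have msum : measurable_fun [set: T] (fun t => \sum_(j < n) young_term r (b j) t)%E.
  by apply: emeasurable_sum => j _; exact: measurable_young_term.
rewrite -(@integral_young_term p a0)//.
under eq_bigr do rewrite -integral_young_term//.
rewrite -ge0_integral_sum//; last 2 first.
- by move=> j; exact: measurable_young_term.
- by move=> j t _; exact: young_term_ge0.
rewrite -ge0_integralD//; last 2 first.
- by move=> t _; exact: young_term_ge0.
- exact: measurable_young_term.
apply: ae_ge0_le_integral => //.
- exact: mfun.
- by move=> t _; rewrite adde_ge0// young_term_ge0.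
- by apply: emeasurable_funD => //; exact: measurable_young_term.
apply: filterS domin => t at_le _.
under eq_bigr do rewrite /young_term -!EFinM -EFinD.
rewrite sumEFin /young_term -!EFinM -!EFinD lee_fin powRM//.
apply: le_trans (ler_wpM2r (powR_ge0 _ _) at_le) _.
rewrite mulrDl lerD ?young_mul// mulr_suml.
by apply: ler_sum => j _; rewrite young_mul.
Qed.

End integrated_young.

(** Cancels a positive factor in front of an integral not yet known to be finite. *)
Lemma EFin_pmul2l_le (R : realFieldType) (k y : R) (x : \bar R) :
  0 < k -> (k%:E * x <= (k * y)%:E)%E -> (x <= y%:E)%E.
Proof. by move=> k0; rewrite EFinM lee_pmul2l ?lte_fin. Qed.

(** * Choice of the scaling parameters *)

Section scaling_parameters.
Context {R : realType}.
Variables (al be th0 th1 : R).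
Hypotheses (al0 : 0 < al) (be0 : 0 < be) (th01 : th0 != th1).

(** Dividing the requirements s c^(-th0) = al and s c^(-th1) = be gives c^(th1 - th0) = al / be; the
    first requirement then gives [s]. *)
Let c := (al / be) `^ (th1 - th0)^-1.
Let s := al * c `^ th0.

Let ab0 : 0 < al / be. Proof. exact: divr_gt0. Qed.

Let th10 : th1 - th0 != 0. Proof. by rewrite subr_eq0 eq_sym. Qed.

Let s_powRE th : s * c `^ (- th) = al * (al / be) `^ ((th0 - th) / (th1 - th0)).
Proof.
rewrite /s -mulrA -powRD ?(gt_eqF (powR_gt0 _ ab0)) ?implybT//.
by rewrite -powRrM [_ * (th0 - th)]mulrC.
Qed.

Lemma scaling_parameters : exists c s, [/\ 0 < c, 0 < s,
  s * c `^ (- th0) = al, s * c `^ (- th1) = be &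
  forall th, let g := (th1 - th) / (th1 - th0) in
    s * c `^ (- th) = al `^ g * be `^ (1 - g)].
Proof.
exists c, s; rewrite !s_powRE; split.
- exact: powR_gt0.
- by rewrite mulr_gt0 ?powR_gt0.
- by rewrite subrr mul0r powRr0 mulr1.
- rewrite -opprB mulNr divff// powR_inv1 ?invf_div ?ltW// mulrC mulfVK//.
  by rewrite gt_eqF.
move=> th g; rewrite s_powRE.
have -> : (th0 - th) / (th1 - th0) = - (1 - g) by rewrite /g; field.
rewrite powRN powR_div ?ltW// invf_div mulrA mulrAC; congr (_ * _).
have alg : al `^ (1 - g) != 0 by rewrite gt_eqF ?powR_gt0.
apply: (mulIf alg); rewrite mulfVK// -powRD ?(gt_eqF al0) ?implybT//.
by rewrite subrKC powRr1// ltW.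
Qed.

End scaling_parameters.

(** * The inequality by scaling, given a dominating function *)

Section carlson_extremal.
Context {R : realType} {V : lmodType R}.
Context {disp : measure_display} {T : measurableType disp}.
Variables (iota : T -> V) (d : R) (mu : {measure set T -> \bar R}).
Hypothesis coneT : is_cone iota.
Hypothesis mu_hom : homogeneous_measure iota d mu.
Variables (p q r : R) (n : nat).
Variables (a a0 : T -> R) (b : 'I_n -> T -> R) (v : T -> R).
Variables (theta theta0 theta1 : R).
Hypotheses (q0 : 0 < q) (qp : q <= p) (qr : q <= r).
Hypotheses (a_hom : homogeneous iota theta a) (a0_hom : homogeneous iota theta0 a0).
Hypothesis b_hom : forall j, homogeneous iota theta1 (b j).
Hypotheses (ma : measurable_fun setT a) (ma0 : measurable_fun setT a0).
Hypothesis mb : forall j, measurable_fun setT (b j).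
Hypothesis mv : measurable_fun setT v.
Hypotheses (a_ge0 : forall t, 0 <= a t) (a0_ge0 : forall t, 0 <= a0 t).
Hypotheses (b_ge0 : forall j t, 0 <= b j t) (v_ge0 : forall t, 0 <= v t).
Hypothesis domin : {ae mu, forall t, a t `^ q <=
  a0 t `^ p * v t `^ (p - q) + \sum_(j < n) b j t `^ r * v t `^ (r - q)}.
Variables (I1 I2 : R).
Hypotheses (I1_gt0 : 0 < I1) (I2_gt0 : 0 < I2).
Hypothesis intI1 : (\int[mu]_t ((a0 t * v t) `^ p)%:E = I1%:E)%E.
Hypothesis intI2 : forall j, (\int[mu]_t ((b j t * v t) `^ r)%:E = I2%:E)%E.

Let th := theta + d / q.
Let th0 := theta0 + d / p.
Let th1 := theta1 + d / r.
Let g := (th1 - th) / (th1 - th0).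
Hypothesis th01 : th0 != th1.

Lemma carlson_extremal_bound (u : T -> R) (A M : R) :
  measurable_fun setT u -> (forall t, 0 <= u t) -> 0 < A -> 0 < M ->
  (\int[mu]_t ((a0 t * u t) `^ p)%:E = (A `^ p)%:E)%E ->
  (forall j, \int[mu]_t ((b j t * u t) `^ r)%:E <= (M `^ r)%:E)%E ->
  (\int[mu]_t ((a t * u t) `^ q)%:E <=
   ((I1 `^ (- g / p) * I2 `^ (- (1 - g) / r) * (I1 + n%:R * I2) `^ q^-1 *
     (A `^ g * M `^ (1 - g))) `^ q)%:E)%E.
Proof.
move=> mu_ u0 A0 M0 intA intM.
have p0 : 0 < p by exact: lt_le_trans qp.
have r0 : 0 < r by exact: lt_le_trans qr.
(* These are the targets for the scaling: the rescaled function U satisfies int (a0 U)^p = I1 and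
   int (b_j U)^r <= I2. *)
have al0 : 0 < I1 `^ p^-1 / A by rewrite divr_gt0 ?powR_gt0.
have be0 : 0 < I2 `^ r^-1 / M by rewrite divr_gt0 ?powR_gt0.
have [c [s [c0 s0 sc0 sc1 /(_ th)]]] := scaling_parameters al0 be0 th01.
rewrite -/g /= => sc.
have [dil dilE] := choice (fun t => coneT.2 c t c0).
have mdil := measurable_dilation coneT mu_hom c0 dilE.
have rescale := ge0_integral_rescale coneT mu_hom c0 dilE.
have mU : measurable_fun setT (fun t => s * u (dil t)).
  by apply: measurable_funM => //; exact: measurableT_comp mu_ mdil.
have U0 t : 0 <= s * u (dil t) by rewrite mulr_ge0 ?(ltW s0).
have := integral_le_young q0 qp qr ma ma0 mb mU mv a_ge0 a0_ge0 b_ge0 U0 v_ge0 domin.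
rewrite (rescale _ _ _ _ _ q0 (ltW s0) a_hom ma mu_ a_ge0 u0).
rewrite (rescale _ _ _ _ _ p0 (ltW s0) a0_hom ma0 mu_ a0_ge0 u0).
rewrite -/th -/th0 sc0 sc intA intI1 -!EFinM -EFinD.
(* [D] is the factor by which the scaling multiplies the integral to be bounded. *)
set D := (_ `^ g * _) `^ q; set X := (\int[mu]_t _)%E.
have D0 : 0 < D by rewrite powR_gt0// mulr_gt0 ?powR_gt0.
set S := (\sum_(j < n) _)%E => le_young.
(* The Young weights [q / r] and [1 - q / r] add up to 1, so each of the [n] terms is at most
   [I2]. *)
have S_le : (S <= (n%:R * I2)%:E)%E.
  rewrite mulr_natl -[n in _ *+ n]card_ord -sumr_const -sumEFin.
  apply: lee_sum => j _.
  rewrite (rescale _ _ _ _ _ r0 (ltW s0) (b_hom j) (mb j) mu_ (b_ge0 j) u0).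
  rewrite -/th1 sc1 intI2.
  have e2 : (I2 `^ r^-1 / M) `^ r * M `^ r = I2.
    rewrite -powRM ?(ltW be0, ltW M0)// mulfVK ?gt_eqF//.
    by rewrite powRVK ?gt_eqF ?ltW.
  rewrite [leRHS](_ : _ = ((q / r)%:E * (((I2 `^ r^-1 / M) `^ r)%:E * (M `^ r)%:E) +
      (1 - q / r)%:E * I2%:E)%E); last first.
    by rewrite -!EFinM e2 -EFinD -mulrDl subrKC mul1r.
  apply: leeD => //; rewrite lee_pmul2l ?lte_fin ?divr_gt0//.
  apply: lee_wpmul2l; last exact: (intM j).
  by rewrite lee_fin powR_ge0.
have : (D%:E * X <= (I1 + n%:R * I2)%:E)%E.
  apply: le_trans le_young _; rewrite [leRHS]EFinD; apply: leeD => //.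
  rewrite lee_fin -powRM ?(ltW al0, ltW A0)// mulfVK ?gt_eqF//.
  by rewrite powRVK ?gt_eqF ?(ltW I1_gt0)// -mulrDl subrKC mul1r.
(* The base of [D] equals I1^(g/p) I2^((1-g)/r) / (A^g M^(1-g)), so multiplying by [D] cancels
   everything in the claimed bound except I1 + n I2. *)
have eD : I1 + n%:R * I2 = D * (I1 `^ (- g / p) * I2 `^ (- (1 - g) / r) *
    (I1 + n%:R * I2) `^ q^-1 * (A `^ g * M `^ (1 - g))) `^ q.
  have sum0 : 0 <= I1 + n%:R * I2.
    by rewrite addr_ge0 ?mulr_ge0 ?ler0n ?(ltW I1_gt0) ?(ltW I2_gt0).
  rewrite /D -powRM; [|by rewrite !(mulr_ge0, powR_ge0)..].
  rewrite -[LHS](powRVK sum0 (lt0r_neq0 q0)); congr (_ `^ _).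
  rewrite !powR_div ?powR_ge0 ?(ltW A0) ?(ltW M0)// -!powRrM.
  rewrite [- g / p]mulNr [- (1 - g) / r]mulNr !powRN [p^-1 * _]mulrC [r^-1 * _]mulrC.
  have A1 : A `^ g != 0 by rewrite gt_eqF ?powR_gt0.
  have M1 : M `^ (1 - g) != 0 by rewrite gt_eqF ?powR_gt0.
  have I11 : I1 `^ (g / p) != 0 by rewrite gt_eqF ?powR_gt0.
  have I21 : I2 `^ ((1 - g) / r) != 0 by rewrite gt_eqF ?powR_gt0.
  by field; rewrite A1 M1 I11 I21.
by move=> le_DX; apply: (EFin_pmul2l_le D0); rewrite -eD.
Qed.

End carlson_extremal.

(** * The modulus on real and complex scalars *)

Section scalars.
Context {R : realType} {K : scalar_kind}.
Context {disp : measure_display} {T : measurableType disp}.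
Implicit Types (z : scalar_field R K) (f g : T -> scalar_field R K).

(** The extremal function is real; this embedding turns it into a test function over either
    field. *)
Definition real_scalar (K : scalar_kind) (x : R) : scalar_field R K :=
  match K return scalar_field R K with
  | RealScalars => x
  | ComplexScalars => Complex x 0
  end.

Lemma modulus_ge0 z : 0 <= modulus z.
Proof. by case: K z => [x|[x y]] /=; rewrite ?normr_ge0 ?sqrtr_ge0. Qed.

Lemma modulusM z1 z2 : modulus (z1 * z2) = modulus z1 * modulus z2.
Proof.
by case: K z1 z2 => z1 z2 /=; [exact: normrM|exact: ComplexField.Normc.normcM].
Qed.

Lemma modulus_eq0 z : modulus z = 0 <-> z = 0.
Proof.
split=> [|->]; case: K z => z /=.
- by move/normr0_eq0.
- exact: ComplexField.Normc.eq0_normc.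
- by rewrite normr0.
- exact: ComplexField.Normc.normc0.
Qed.

Lemma modulus_real_scalar (x : R) : modulus (real_scalar K x) = `|x|.
Proof. by case: K => //=; rewrite expr0n addr0 sqrtr_sqr. Qed.

Lemma measurable_modulus f : scalar_measurable f ->
  measurable_fun [set: T] (fun t => modulus (f t)).
Proof.
case: K f => f /=; first exact: measurableT_comp.
move=> [mRe mIm].
rewrite (_ : (fun t => _) = (fun t =>
    (complex.Re (f t) ^+ 2 + complex.Im (f t) ^+ 2) `^ 2^-1)).
  apply: (measurableT_comp (measurable_powR _)).
  by apply: measurable_funD; exact: measurable_funX.
apply/funext => t; rewrite powR12_sqrt ?addr_ge0 ?sqr_ge0//.
by case: (f t).
Qed.

Lemma scalar_measurableM f g : scalar_measurable f -> scalar_measurable g ->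
  scalar_measurable (fun t => f t * g t).
Proof.
case: K f g => f g /=; first exact: measurable_funM.
move=> [mRef mImf] [mReg mImg]; split.
  rewrite (_ : (fun t => _) = (fun t => complex.Re (f t) * complex.Re (g t) -
      complex.Im (f t) * complex.Im (g t))).
    by apply: measurable_funB; exact: measurable_funM.
  by apply/funext => t; case: (f t) (g t) => ? ? [].
rewrite (_ : (fun t => _) = (fun t => complex.Re (f t) * complex.Im (g t) +
    complex.Im (f t) * complex.Re (g t))).
  by apply: measurable_funD; exact: measurable_funM.
by apply/funext => t; case: (f t) (g t) => ? ? [].
Qed.

Lemma scalar_measurable_real (f : T -> R) : measurable_fun [set: T] f ->
  scalar_measurable (fun t => real_scalar K (f t)).
Proof. by case: K. Qed.

End scalars.

(** * Norms as roots of integrals of powers of the modulus *)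

Section Lp_norms.
Context {R : realType} {disp : measure_display} {T : measurableType disp}.
Variable mu : {measure set T -> \bar R}.

Lemma ae_eq0_integral_powR (s : R) (f : T -> R) : 0 < s ->
  measurable_fun [set: T] f -> (forall t, 0 <= f t) ->
  (\int[mu]_t ((f t) `^ s)%:E = 0)%E <-> {ae mu, forall t, f t = 0}.
Proof.
move=> s0 mf f0.
have mfs : measurable_fun [set: T] (fun t => ((f t) `^ s)%:E).
  exact/measurable_EFinP/(measurableT_comp (measurable_powR _)).
have := ae_eq_integral_abs mu measurableT mfs.
under eq_integral => t _ do rewrite /= ger0_norm ?powR_ge0//.
move=> ->; split; apply: filterS => t.
  by move=> /(_ I) [] /powR_eq0_eq0.
by move=> -> _; rewrite powR0 ?gt_eqF.
Qed.

Context {K : scalar_kind}.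
Implicit Types f : T -> scalar_field R K.

Lemma Lp_normE (s : R) f :
  (Lp_norm mu s f = (\int[mu]_t (modulus (f t) `^ s)%:E) `^ s^-1)%E.
Proof.
rewrite /Lp_norm unlock; congr (_ `^ _)%E.
by apply: eq_integral => t _; rewrite /= ger0_norm ?modulus_ge0.
Qed.

Lemma integral_modulus_ge0 (s : R) f :
  (0 <= \int[mu]_t (modulus (f t) `^ s)%:E)%E.
Proof. by apply: integral_ge0 => t _; rewrite lee_fin powR_ge0. Qed.

Lemma Lp_norm_ge0 (s : R) f : (0 <= Lp_norm mu s f)%E.
Proof. by rewrite Lp_normE poweR_ge0. Qed.

Lemma Lp_norm_eq0 (s : R) f : 0 < s -> scalar_measurable f ->
  (Lp_norm mu s f = 0)%E -> {ae mu, forall t, f t = 0}.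
Proof.
move=> s0 mf; rewrite Lp_normE => /(poweR_eq0_eq0 (integral_modulus_ge0 _ _)).
move/(ae_eq0_integral_powR s0 (measurable_modulus mf) (fun=> modulus_ge0 _)).1.
by apply: filterS => t /modulus_eq0.
Qed.

Lemma integral_Lp_norm (s : R) f : 0 < s ->
  (\int[mu]_t (modulus (f t) `^ s)%:E = Lp_norm mu s f `^ s)%E.
Proof.
move=> s0; rewrite Lp_normE -poweRrM mulVf ?gt_eqF// poweRe1//.
exact: integral_modulus_ge0.
Qed.

End Lp_norms.

(** * The sharp inequality for an abstract extremal function *)

Section sharp_carlson.
Context {R : realType} {K : scalar_kind} {V : lmodType R}.
Context {disp : measure_display} {T : measurableType disp}.
Variables (iota : T -> V) (d : R) (mu : {measure set T -> \bar R}).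
Hypothesis coneT : is_cone iota.
Hypothesis mu_hom : homogeneous_measure iota d mu.
Variables (p q r : R) (n : nat) (hn : (0 < n)%N).
Variables (w w0 : T -> scalar_field R K) (w_ : 'I_n -> T -> scalar_field R K).
Variables (theta theta0 theta1 : R).
Hypotheses (mw : scalar_measurable w) (mw0 : scalar_measurable w0).
Hypothesis mw_ : forall j, scalar_measurable (w_ j).
Hypotheses (w_hom : homogeneous iota theta (fun t => modulus (w t)))
           (w0_hom : homogeneous iota theta0 (fun t => modulus (w0 t))).
Hypothesis w__hom : forall j, homogeneous iota theta1 (fun t => modulus (w_ j t)).
Hypothesis w0_neq0 : {ae mu, forall t, w0 t <> 0}.
Hypothesis sum_neq0 : {ae mu, forall t, \sum_(j < n) modulus (w_ j t) <> 0}.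
Hypotheses (q0 : 0 < q) (qp : q <= p) (qr : q <= r).
Variable v : T -> R.
Hypotheses (mv : measurable_fun [set: T] v) (v_ge0 : forall t, 0 <= v t).

(* Stationarity of [a^q u^q - (q/p) a0^p u^p - (q/r) sum_j b_j^r u^r] at [u = v]. *)
Hypothesis v_extremal : {ae mu, forall t,
  let rhs := modulus (w0 t) `^ p * v t `^ (p - q) +
             \sum_(j < n) modulus (w_ j t) `^ r * v t `^ (r - q) in
  modulus (w t) `^ q <= rhs /\ (v t != 0 -> modulus (w t) `^ q = rhs)}.
Variables I1 I2 : R.
Hypothesis I1_gt0 : 0 < I1.
Hypothesis intI1 : (\int[mu]_t ((modulus (w0 t) * v t) `^ p)%:E = I1%:E)%E.
Hypothesis intI2 : forall j,
  (\int[mu]_t ((modulus (w_ j t) * v t) `^ r)%:E = I2%:E)%E.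

Let th := theta + d / q.
Let th0 := theta0 + d / p.
Let th1 := theta1 + d / r.
Let g := (th1 - th) / (th1 - th0).
Hypothesis th01 : th0 != th1.
Let C := I1 `^ (- g / p) * I2 `^ (- (1 - g) / r) * (I1 + n%:R * I2) `^ q^-1.

Let p0 : 0 < p. Proof. exact: lt_le_trans qp. Qed.
Let r0 : 0 < r. Proof. exact: lt_le_trans qr. Qed.

Let ma : measurable_fun [set: T] (fun t => modulus (w t)).
Proof. exact: measurable_modulus. Qed.
Let ma0 : measurable_fun [set: T] (fun t => modulus (w0 t)).
Proof. exact: measurable_modulus. Qed.
Let mb j : measurable_fun [set: T] (fun t => modulus (w_ j t)).
Proof. exact: measurable_modulus. Qed.

(** At almost every point some [w_ j t] is nonzero and can be cancelled. *)
Let ae_all_eq0 (f : T -> scalar_field R K) :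
  (forall j, {ae mu, forall t, w_ j t * f t = 0}) -> {ae mu, forall t, f t = 0}.
Proof.
move=> /filter_forall wf0; apply: filterS2 sum_neq0 wf0 => t /eqP.
rewrite psumr_neq0 => [/hasP[j _ /andP[_ wj0]] /(_ j)/eqP|j _]; last exact: modulus_ge0.
by rewrite mulf_eq0 => /orP[/eqP/modulus_eq0 wj|/eqP//]; rewrite wj ltxx in wj0.
Qed.

Let v_neq0 : ~ {ae mu, forall t, real_scalar K (v t) = 0}.
Proof.
move=> v_eq0; suff : I1%:E = 0%:E by case=> I10; move: I1_gt0; rewrite I10 ltxx.
rewrite -intI1; apply/(ae_eq0_integral_powR mu p0).
- exact: measurable_funM.
- by move=> t; rewrite mulr_ge0 ?modulus_ge0.
apply: filterS v_eq0 => t /modulus_eq0; rewrite modulus_real_scalar.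
by move=> /normr0_eq0 ->; rewrite mulr0.
Qed.

Let modulus_v f t : modulus (f t * real_scalar K (v t)) = modulus (f t) * v t.
Proof. by rewrite modulusM modulus_real_scalar ger0_norm. Qed.

Let I2_ge0 : 0 <= I2.
Proof.
rewrite -lee_fin -(intI2 (Ordinal hn)); apply: integral_ge0 => t _.
by rewrite lee_fin powR_ge0.
Qed.

(** If [I2] were 0, every product of [w_ j] and [v] would vanish almost everywhere, hence so would
    [v], against [v_neq0], which rests on [I1_gt0]. *)
Let I2_gt0 : 0 < I2.
Proof.
rewrite lt_neqAle I2_ge0 andbT; apply/negP => /eqP I20; apply: v_neq0.
apply: ae_all_eq0 => j.
have : (\int[mu]_t ((modulus (w_ j t) * v t) `^ r)%:E = 0)%E by rewrite intI2 -I20.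
have wv0 t : 0 <= modulus (w_ j t) * v t by rewrite mulr_ge0 ?modulus_ge0.
move/(ae_eq0_integral_powR mu r0 (measurable_funM (mb j) mv) wv0).1.
by apply: filterS => t; rewrite /= -modulus_v => /modulus_eq0.
Qed.

Lemma extremal_carlson_inequality : carlson_inequality mu p q r w w0 w_ g C.
Proof.
move=> x [mx x_neq0 [mw0x w0x_lty] w_x].
pose u t := modulus (x t).
have mu_ : measurable_fun [set: T] u by exact: measurable_modulus.
have u0 t : 0 <= u t by exact: modulus_ge0.
have Lp_fin s (f : T -> scalar_field R K) : in_Lp mu s f ->
    exists2 y : R, 0 <= y & Lp_norm mu s f = y%:E.
  move=> [_ f_lty]; have := Lp_norm_ge0 mu s f.
  by case: (Lp_norm mu s f) f_lty => // y _ y0; exists y.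
have [A A_ge0 normA] := Lp_fin _ _ (conj mw0x w0x_lty).
set N := (X in (_ <= _ * (_ * X `^ _))%E).
have NE j : (Lp_norm mu r (fun t => w_ j t * x t)%R <= N)%E by exact: le_bigmax.
have [M M_ge0 normM] : exists2 M : R, 0 <= M & N = M%:E.
  have : (N < +oo)%E by apply: bigmax_lt => // j _; case: (w_x j).
  have : (0 <= N)%E by exact: le_trans (Lp_norm_ge0 _ _ _) (NE (Ordinal hn)).
  by case: (N) => // M M0 _; exists M.
(* The scaling divides by [A] and by [M]; if either were 0, [x] would vanish almost everywhere. *)
have A_gt0 : 0 < A.
  rewrite lt_neqAle A_ge0 andbT; apply/negP => /eqP A0; apply: x_neq0.
  rewrite -A0 in normA.
  apply: filterS2 w0_neq0 (Lp_norm_eq0 p0 mw0x normA) => t /eqP w0t /eqP.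
  by rewrite mulf_eq0 (negbTE w0t) => /eqP.
have M_gt0 : 0 < M.
  rewrite lt_neqAle M_ge0 andbT; apply/negP => /eqP M0; apply: x_neq0.
  apply: ae_all_eq0 => j; apply: (Lp_norm_eq0 r0 (w_x j).1).
  by apply/eqP; rewrite eq_le Lp_norm_ge0 andbT (le_trans (NE j))// normM -M0.
have intA : (\int[mu]_t ((modulus (w0 t) * u t) `^ p)%:E = (A `^ p)%:E)%E.
  rewrite -poweR_EFin -normA -integral_Lp_norm//.
  by apply: eq_integral => t _; rewrite modulusM.
have intM j : (\int[mu]_t ((modulus (w_ j t) * u t) `^ r)%:E <= (M `^ r)%:E)%E.
  rewrite -poweR_EFin -normM (le_trans _ (gt0_ler_poweR (ltW r0) _ _ (NE j)))//.
  - rewrite -integral_Lp_norm//.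
    by under eq_integral => t _ do rewrite -modulusM.
  - by rewrite in_itv/= Lp_norm_ge0 leey.
  - by rewrite in_itv/= normM lee_fin M_ge0 leey.
have domin : {ae mu, forall t, modulus (w t) `^ q <=
    modulus (w0 t) `^ p * v t `^ (p - q) +
    \sum_(j < n) modulus (w_ j t) `^ r * v t `^ (r - q)}.
  by apply: filterS v_extremal => t [].
have := carlson_extremal_bound coneT mu_hom q0 qp qr w_hom w0_hom w__hom ma ma0 mb
  mv (fun=> modulus_ge0 _) (fun=> modulus_ge0 _) (fun _ _ => modulus_ge0 _) v_ge0
  domin I1_gt0 I2_gt0 intI1 intI2 th01 mu_ u0 A_gt0 M_gt0 intA intM.
rewrite -/th -/th0 -/th1 -/g -/C => le_int.
rewrite Lp_normE normA normM !poweR_EFin -!EFinM.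
set D := C * _ in le_int *.
have D0 : 0 <= D by rewrite !mulr_ge0 ?powR_ge0.
(* With [D] written as the q-th root of D^q, monotonicity of the root leaves exactly the bound
   [le_int] on integrals. *)
rewrite -[D in leRHS](powRK D0 (lt0r_neq0 q0)) -poweR_EFin.
apply: gt0_ler_poweR.
- by rewrite invr_ge0 ltW.
- by rewrite in_itv/= integral_modulus_ge0 leey.
- by rewrite in_itv/= lee_fin powR_ge0 leey.
by under eq_integral => t _ do rewrite modulusM.
Qed.

(** Where [v] is nonzero, [v_extremal] is an equality; multiplied by v^q it splits (a v)^q into (a0
    v)^p and the terms (b_j v)^r. Where [v] is 0 all these terms vanish. *)
Let int_wv :
  (\int[mu]_t ((modulus (w t) * v t) `^ q)%:E = (I1 + n%:R * I2)%:E)%E.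
Proof.
have mfun s (f : T -> R) : measurable_fun [set: T] f ->
    measurable_fun [set: T] (fun t => ((f t * v t) `^ s)%:E).
  move=> mf; apply/measurable_EFinP/(measurableT_comp (measurable_powR _)).
  exact: measurable_funM.
have msum : measurable_fun [set: T]
    (fun t => \sum_(j < n) ((modulus (w_ j t) * v t) `^ r)%:E)%E.
  by apply: emeasurable_sum => j _; exact: mfun.
have sum_ge0 t : (0 <= \sum_(j < n) ((modulus (w_ j t) * v t) `^ r)%:E)%E.
  by apply: sume_ge0 => j _; rewrite lee_fin powR_ge0.
transitivity (\int[mu]_t (((modulus (w0 t) * v t) `^ p)%:E +
    \sum_(j < n) ((modulus (w_ j t) * v t) `^ r)%:E))%E.
  apply: ge0_ae_eq_integral => //.
  - exact: mfun.
  - by apply: emeasurable_funD => //; exact: mfun.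
  - by move=> t _; rewrite lee_fin powR_ge0.
  - by move=> t _; rewrite adde_ge0// lee_fin powR_ge0.
  apply: filterS v_extremal => t [_ ext] _; rewrite sumEFin -EFinD; congr EFin.
  have [v0|/[dup] vN0 /ext aE] := eqVneq (v t) 0.
    rewrite v0 !mulr0 !powR0 ?gt_eqF// big1 ?addr0// => j _.
    by rewrite mulr0 powR0 ?gt_eqF.
  have vD s : v t `^ s = v t `^ (s - q) * v t `^ q.
    by rewrite -powRD ?subrK// vN0 implybT.
  rewrite !powRM ?modulus_ge0// aE mulrDl mulr_suml -mulrA -vD; congr (_ + _).
  by apply: eq_bigr => j _; rewrite powRM ?modulus_ge0// (vD r) mulrA.
rewrite ge0_integralD//; last 2 first.
- by move=> t _; rewrite lee_fin powR_ge0.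
- exact: mfun.
rewrite ge0_integral_sum//; last 2 first.
- by move=> j; exact: mfun.
- by move=> j t _; rewrite lee_fin powR_ge0.
rewrite intI1; under eq_bigr do rewrite intI2.
by rewrite sumEFin sumr_const card_ord -EFinD mulr_natl.
Qed.

Let Lp_norm_v s (f : T -> scalar_field R K) (I : R) :
  (\int[mu]_t ((modulus (f t) * v t) `^ s)%:E = I%:E)%E ->
  Lp_norm mu s (fun t => f t * real_scalar K (v t)) = (I `^ s^-1)%:E.
Proof.
move=> intf; rewrite Lp_normE -poweR_EFin -intf; congr (_ `^ _)%E.
by apply: eq_integral => t _; rewrite modulus_v.
Qed.

Lemma extremal_carlson_sharp C' :
  carlson_inequality mu p q r w w0 w_ g C' -> C <= C'.
Proof.
move=> /(_ (fun t => real_scalar K (v t))).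
have mx := @scalar_measurable_real _ K _ _ _ mv.
have adm : admissible mu p r w0 w_ (fun t => real_scalar K (v t)).
  split=> // [|j]; split; first exact: scalar_measurableM.
  - by rewrite (Lp_norm_v intI1) ltry.
  - exact: scalar_measurableM.
  - by rewrite (Lp_norm_v (intI2 j)) ltry.
move=> /(_ adm); rewrite (Lp_norm_v int_wv) (Lp_norm_v intI1).
under eq_bigr do rewrite (Lp_norm_v (intI2 _)).
(* [hn] supplies an index; over an empty range the maximum would be 0. *)
have -> : (\big[maxe/0]_(j < n) (I2 `^ r^-1)%:E = (I2 `^ r^-1)%:E)%E.
  apply/eqP; rewrite eq_le; apply/andP; split.
    by apply: bigmax_le => //; rewrite lee_fin powR_ge0.
  exact: (@le_bigmax _ _ _ 0%E (fun=> (I2 `^ r^-1)%:E) (Ordinal hn)).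
rewrite !poweR_EFin -!EFinM lee_fin -!powRrM => le_C'.
have J1 : 0 < I1 `^ (g / p) by exact: powR_gt0.
have J2 : 0 < I2 `^ ((1 - g) / r) by exact: powR_gt0.
(* The negative powers in [C] are the inverses of the norm factors of [v], so [C <= C'] is [le_C']
   after division by them. *)
rewrite /C [- g / p]mulNr [- (1 - g) / r]mulNr !powRN -invfM mulrC.
by rewrite ler_pdivrMr ?mulr_gt0// [g / p]mulrC [(1 - g) / r]mulrC.
Qed.

End sharp_carlson.

(** * The equation that defines [ktilde_P] *)

Section kappa.
Context {R : realType}.
Variables al be : R.
Hypotheses (al0 : 0 < al) (be0 : 0 < be).

(* [ktilde_P] is [kappa (p - q)^-1 (r - q)^-1] composed with the right-hand side of
   its defining equation, so the monotonicity of [kappa] makes it measurable. *)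
Definition kappa (y : R) : R :=
  xget 0 [set k | (0 <= k < 1) /\ k `^ al / (1 - k) `^ be = y].

(** The intermediate value theorem is applied on [0, 1] to k^al - y (1 - k)^be, which avoids the
    pole of the quotient at 1. Its value 1 at k = 1 then excludes that endpoint as a root. *)
Lemma kappa_exists (y : R) : 0 <= y ->
  exists k : R, (0 <= k < 1) /\ k `^ al / (1 - k) `^ be = y.
Proof.
move=> y0; pose h (k : R) := `|k| `^ al - y * `|1 - k| `^ be.
have h_cont : continuous h.
  move=> k; apply: cvgB; first exact: continuous_norm_powR.
  apply: cvgM; first exact: cvg_cst.
  apply: (@continuous_comp _ _ _ (fun k : R => 1 - k) (fun x => `|x| `^ be)).
    by apply: cvgB; [exact: cvg_cst|exact: cvg_id].
  exact: continuous_norm_powR.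
have h0 : h 0 <= 0.
  by rewrite /h normr0 powR0 ?gt_eqF// subr0 normr1 powR1 mulr1 sub0r oppr_le0.
have h1 : h 1 = 1.
  by rewrite /h normr1 powR1 subrr normr0 (powR0 (lt0r_neq0 be0)) mulr0 subr0.
have [||k] := @IVT R h 0 1 0 ler01.
- exact: continuous_subspaceT.
- by rewrite ge_min h0/= le_max h1 ler01 orbT.
rewrite in_itv/= => /andP[k0 k1] hk; exists k.
have k_lt1 : k < 1.
  rewrite lt_neqAle k1 andbT; apply/eqP => kE.
  by move: hk; rewrite kE h1 => /eqP; rewrite oner_eq0.
rewrite k0 k_lt1; split=> //.
have k'0 : 0 < 1 - k by rewrite subr_gt0.
move/eqP: hk; rewrite /h subr_eq0 !ger0_norm ?(ltW k'0)// => /eqP ->.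
by rewrite mulfK// gt_eqF ?powR_gt0.
Qed.

Lemma kappaP (y : R) : 0 <= y ->
  (0 <= kappa y < 1) /\ kappa y `^ al / (1 - kappa y) `^ be = y.
Proof. by move=> /kappa_exists kE; exact: (xgetPex 0 kE). Qed.

(** For negative [y] there is no solution; the default value 0 keeps [kappa] monotone on the whole
    line. *)
Lemma kappa_lt0 (y : R) : y < 0 -> kappa y = 0.
Proof.
move=> y0; apply: xgetPN => k [_ ky].
by move: y0; rewrite -ky ltNge divr_ge0 ?powR_ge0.
Qed.

(** The quotient k^al / (1 - k)^be strictly increases with k on [0, 1[, so a strictly smaller
    solution forces a strictly smaller [y]. *)
Lemma kappa_nondecreasing : nondecreasing_fun kappa.
Proof.
move=> x y xy; have [x0|x0] := ltP x 0.
  rewrite (kappa_lt0 x0); have [y0|/kappaP[/andP[]]//] := ltP y 0.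
  by rewrite kappa_lt0.
have [/andP[kx0 kx1] kxE] := kappaP x0.
have [/andP[ky0 ky1] kyE] := kappaP (le_trans x0 xy).
rewrite leNgt; apply/negP => kyx; move: xy; rewrite leNgt => /negP; apply.
rewrite -kxE -kyE.
have kx' : 0 < 1 - kappa x by rewrite subr_gt0.
have ky' : 0 < 1 - kappa y by rewrite subr_gt0.
apply: (@lt_le_trans _ _ (kappa x `^ al / (1 - kappa y) `^ be)).
  by rewrite ltr_pM2r ?invr_gt0 ?powR_gt0// gt0_ltr_powR.
rewrite ler_wpM2l ?powR_ge0// lef_pV2 ?posrE ?powR_gt0//.
by rewrite ge0_ler_powR ?nnegrE ?(ltW be0) ?(ltW kx') ?(ltW ky')// lerB ?(ltW kyx).
Qed.

Lemma measurable_kappa : measurable_fun [set: R] kappa.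
Proof. exact: nondecreasing_measurable kappa_nondecreasing. Qed.

End kappa.

(** * Pointwise formulas for the extremal value *)

Section extremal_pointwise.
Context {R : realType}.
Implicit Types a b k p q r : R.

(** For nonzero [a0], the solution v of a0^p v^(p-q) = k a^q: [k] is the share of a^q assigned to
    the [a0] term. *)
Definition extremal_value a a0 k p q : R := (k * a `^ q / a0 `^ p) `^ (p - q)^-1.

Variables a a0 k p q : R.
Hypotheses (a_ge0 : 0 <= a) (a0_ge0 : 0 <= a0) (k_ge0 : 0 <= k).
Hypotheses (q0 : 0 < q) (qp : q < p).
Local Notation v := (extremal_value a a0 k p q).

Let pq0 : p - q != 0. Proof. by rewrite subr_eq0 gt_eqF. Qed.
Let p0 : 0 < p. Proof. exact: lt_trans qp. Qed.

Lemma extremal_value_powR s :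
  v `^ s = a `^ (q * s / (p - q)) / a0 `^ (p * s / (p - q)) * k `^ (s / (p - q)).
Proof.
have e x : x * ((p - q)^-1 * s) = x * s / (p - q) by rewrite mulrAC mulrA.
rewrite /extremal_value -powRrM powR_div ?mulr_ge0 ?powR_ge0// powRM ?powR_ge0//.
by rewrite -!powRrM !e [(p - q)^-1 * s]mulrC; ring.
Qed.

Lemma extremal_value_weight0 :
  (a0 * v) `^ p = (a / a0) `^ (q * p / (p - q)) * k `^ (p / (p - q)).
Proof.
rewrite powRM ?powR_ge0// extremal_value_powR powR_div//.
(* At [a0 = 0] both sides are 0, since division by 0 yields 0; the identity therefore holds at every
   point, not only almost everywhere. *)
have [->|a0N0] := eqVneq a0 0.
  have pN0 : p != 0 by rewrite gt_eqF.
  have qN0 : q != 0 by rewrite gt_eqF.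
  by rewrite !powR0 ?mulf_neq0 ?invr_neq0// invr0 !(mulr0, mul0r).
have -> : p * p / (p - q) = p + q * p / (p - q) by field.
rewrite powRD ?a0N0 ?implybT// invfM !mulrA; congr (_ * _).
by field; rewrite !powR_eq0 (negbTE a0N0).
Qed.

Lemma extremal_value_weight b s : 0 <= b ->
  (b * v) `^ s = a `^ (q * s / (p - q)) / a0 `^ (p * s / (p - q)) *
                 b `^ s * k `^ (s / (p - q)).
Proof. by move=> b0; rewrite powRM ?powR_ge0// extremal_value_powR mulrCA !mulrA. Qed.

Lemma extremal_value_stationary0 : a0 != 0 -> a0 `^ p * v `^ (p - q) = k * a `^ q.
Proof.
move=> a0N0; rewrite powRVK ?divr_ge0 ?mulr_ge0 ?powR_ge0//.
by rewrite mulrC divfK// gt_eqF// powR_gt0// lt0r a0N0.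
Qed.

Lemma extremal_value_eq0 : k = 0 -> v = 0.
Proof. by move=> k0; rewrite /extremal_value k0 !mul0r powR0// invr_eq0. Qed.

(** The equation for [k] says that giving the share [k] to the [a0] term and the share [1 - k] to
    the [S] term determines the same v. *)
Lemma extremal_value_stationary r S : q < r -> a != 0 -> a0 != 0 -> 0 < S -> k < 1 ->
  k `^ (p - q)^-1 / (1 - k) `^ (r - q)^-1 =
    (a0 / a) `^ (p / (p - q)) * (S / a `^ r) `^ (- (r - q)^-1) ->
  S * v `^ (r - q) = (1 - k) * a `^ q.
Proof.
move=> qr aN0 a0N0 S0 k1 kE.
have a_gt0 : 0 < a by rewrite lt0r aN0.
have a0_gt0 : 0 < a0 by rewrite lt0r a0N0.
have rq0 : r - q != 0 by rewrite subr_eq0 gt_eqF.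
have k'0 : 0 < 1 - k by rewrite subr_gt0.
(* The right-hand side is the value dictated by the [S] term; substituting the equation for [k] into
   the definition of v yields it. *)
have vE : v = ((1 - k) * a `^ q / S) `^ (r - q)^-1.
  rewrite /extremal_value powR_div ?mulr_ge0 ?powR_ge0// powRM ?powR_ge0//.
  rewrite (_ : k `^ _ = (1 - k) `^ (r - q)^-1 * ((a0 / a) `^ (p / (p - q)) *
    (S / a `^ r) `^ (- (r - q)^-1))); last first.
    by rewrite -kE mulrC divfK// gt_eqF// powR_gt0.
  rewrite !powR_div ?mulr_ge0 ?powR_ge0 ?(ltW S0) ?(ltW k'0)//.
  rewrite powRM ?powR_ge0 ?(ltW k'0)// !powRN.
  rewrite -!powRrM.
  have -> : r / (r - q) = 1 + q / (r - q) by field.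
  have -> : a `^ (p / (p - q)) = a * a `^ (q / (p - q)).
    rewrite -[X in _ = X * _]powRr1//  -powRD ?aN0 ?implybT//.
    by congr (_ `^ _); field.
  rewrite powRD ?aN0 ?implybT// powRr1//.
  field; rewrite aN0/= !gt_eqF ?powR_gt0//.
rewrite vE powRVK ?divr_ge0 ?mulr_ge0 ?powR_ge0 ?(ltW S0) ?(ltW k'0)//.
by rewrite mulrC divfK// gt_eqF.
Qed.

End extremal_pointwise.

(** * The extremal functions for the three parameter sets *)

Section extremal_functions.
Context {R : realType} {K : scalar_kind}.
Context {disp : measure_display} {T : measurableType disp}.
Variables (mu : {measure set T -> \bar R}) (p q r : R) (n : nat).
Variables (w w0 : T -> scalar_field R K) (w_ : 'I_n -> T -> scalar_field R K).
Hypotheses (mw : scalar_measurable w) (mw0 : scalar_measurable w0).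
Hypothesis mw_ : forall j, scalar_measurable (w_ j).

Local Notation a := (fun t => modulus (w t)).
Local Notation a0 := (fun t => modulus (w0 t)).
Local Notation b := (fun j t => modulus (w_ j t)).

(** On P and P1 the value is read off from the [w0] term. On P2, where [q = p], that term does not
    depend on v, and the value comes from the other weights through v^(r-p) = [ratio_P2]. *)
Definition extremal_function (t : T) : R :=
  if q < p then extremal_value (a t) (a0 t) (ktilde p q r w w0 w_ t) p q
  else ratio_P2 p r w w0 w_ t `^ (r - p)^-1.

Lemma measurable_modulus_powR (f : T -> scalar_field R K) s :
  scalar_measurable f -> measurable_fun [set: T] (fun t => modulus (f t) `^ s).
Proof.
move=> mf; apply: (measurableT_comp (measurable_powR _)).
exact: measurable_modulus.
Qed.

Lemma measurable_div_ge0 (f g : T -> R) : (forall t, 0 <= g t) ->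
  measurable_fun [set: T] f -> measurable_fun [set: T] g ->
  measurable_fun [set: T] (fun t => f t / g t).
Proof.
(* The inverse is rewritten as the power -1, so that measurability of [powR] applies. *)
move=> g0 mf mg; under eq_fun => t do rewrite -powR_inv1//.
by apply: measurable_funM => //; exact: (measurableT_comp (measurable_powR _)).
Qed.

Lemma measurable_ratio_P2 : measurable_fun [set: T] (ratio_P2 p r w w0 w_).
Proof.
apply: measurable_div_ge0.
- by move=> t; apply: sumr_ge0 => j _; exact: powR_ge0.
- apply: measurable_maxr; last exact: measurable_cst.
  by apply: measurable_funB; exact: measurable_modulus_powR.
- by apply: measurable_sum => j; exact: measurable_modulus_powR.
Qed.

Lemma measurable_ktilde : q < p -> measurable_fun [set: T] (ktilde p q r w w0 w_).
Proof.
move=> qp; rewrite /ktilde; case: (boolP (q < r)) => qr.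
  pose rho t := (a0 t / a t) `^ (p / (p - q)) *
    (\sum_(j < n) (b j t / a t) `^ r) `^ (- (r - q)^-1).
  apply: (@measurableT_comp _ _ _ _ _ _ (kappa (p - q)^-1 (r - q)^-1) _ rho).
    by apply: measurable_kappa; rewrite invr_gt0 subr_gt0.
  have mquot (f : T -> scalar_field R K) s : scalar_measurable f ->
      measurable_fun [set: T] (fun t => (modulus (f t) / a t) `^ s).
    move=> mf; apply: (measurableT_comp (measurable_powR _)).
    apply: measurable_div_ge0 => [t||]; first exact: modulus_ge0.
    - exact: measurable_modulus.
    - exact: measurable_modulus.
  apply: measurable_funM; first exact: mquot.
  apply: (measurableT_comp (measurable_powR _)).
  by apply: measurable_sum => j; exact: mquot.
apply: measurable_maxr; last exact: measurable_cst.
apply: measurable_funB; first exact: measurable_cst.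
apply: measurable_funM; first exact: measurable_modulus_powR.
by apply: measurable_sum => j; exact: measurable_modulus_powR.
Qed.

Lemma measurable_extremal_function : measurable_fun [set: T] extremal_function.
Proof.
rewrite /extremal_function; case: (boolP (q < p)) => qp; last first.
  exact: (measurableT_comp (measurable_powR _) measurable_ratio_P2).
apply: (measurableT_comp (measurable_powR _)); apply: measurable_div_ge0.
- by move=> t; exact: powR_ge0.
- by apply: measurable_funM; [exact: measurable_ktilde|exact: measurable_modulus_powR].
- exact: measurable_modulus_powR.
Qed.

Lemma extremal_function_ge0 t : 0 <= extremal_function t.
Proof. by rewrite /extremal_function; case: ifP => _; exact: powR_ge0. Qed.

Lemma ktilde_PP t (k := ktilde_P p q r w w0 w_ t) : q < p -> q < r ->
  (0 <= k < 1) /\ k `^ (p - q)^-1 / (1 - k) `^ (r - q)^-1 =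
    (a0 t / a t) `^ (p / (p - q)) *
    (\sum_(j < n) (b j t / a t) `^ r) `^ (- (r - q)^-1).
Proof.
move=> qp qr; apply: kappaP; rewrite ?invr_gt0 ?subr_gt0//.
by rewrite mulr_ge0 ?powR_ge0.
Qed.

Lemma ktilde_ge0 t : q < p -> 0 <= ktilde p q r w w0 w_ t.
Proof.
move=> qp; rewrite /ktilde; case: ifPn => [qr|_].
  by case: (ktilde_PP t qp qr) => /andP[].
by rewrite le_max lexx orbT.
Qed.

Lemma ratio_P2_ge0 t : 0 <= ratio_P2 p r w w0 w_ t.
Proof.
by rewrite divr_ge0 ?le_max ?lexx ?orbT// sumr_ge0// => j _; exact: powR_ge0.
Qed.

Hypothesis hpqr : in_P p q r \/ in_P1 p q r \/ in_P2 p q r.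

Lemma parameters_bounds : [/\ 0 < q, q <= p & q <= r].
Proof.
case: hpqr => [[q1 qp qr]|[[q1 qr rp]|[q1 qp pr]]].
- by split; [exact: lt_le_trans q1|exact: ltW|exact: ltW].
- by split; [exact: lt_le_trans q1|rewrite qr ltW|rewrite qr].
- by split; [exact: lt_le_trans q1|rewrite qp|rewrite qp ltW].
Qed.

Lemma Itilde_1E : Itilde_1 mu p q r w w0 w_ =
  (\int[mu]_t ((a0 t * extremal_function t) `^ p)%:E)%E.
Proof.
have [q0 _ _] := parameters_bounds.
rewrite /Itilde_1 /extremal_function; case: ifPn => qp.
  apply: eq_integral => t _.
  by rewrite extremal_value_weight0 ?modulus_ge0 ?ktilde_ge0.
apply: eq_integral => t _; rewrite powRM ?modulus_ge0 ?powR_ge0// -powRrM.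
by rewrite [_^-1 * _]mulrC.
Qed.

Lemma Itilde_succE j : Itilde_succ mu p q r w w0 w_ j =
  (\int[mu]_t ((b j t * extremal_function t) `^ r)%:E)%E.
Proof.
have [q0 _ _] := parameters_bounds.
rewrite /Itilde_succ /extremal_function; case: ifPn => qp.
  apply: eq_integral => t _.
  by rewrite extremal_value_weight ?modulus_ge0 ?ktilde_ge0.
apply: eq_integral => t _; rewrite powRM ?modulus_ge0 ?powR_ge0// -powRrM.
by rewrite [_^-1 * _]mulrC.
Qed.

(** On P the two terms carry the shares k and 1 - k of a^q. On P1 and P2 one term is constant in v
    and the other supplies the positive part of what remains: equality holds where the remainder is
    positive, and v = 0 where it is truncated. *)
Lemma extremal_function_stationary t :
  w t <> 0 -> w0 t <> 0 -> \sum_(j < n) b j t <> 0 ->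
  let v := extremal_function t in
  let rhs := a0 t `^ p * v `^ (p - q) + \sum_(j < n) b j t `^ r * v `^ (r - q) in
  a t `^ q <= rhs /\ (v != 0 -> a t `^ q = rhs).
Proof.
move=> wt w0t bt v rhs; rewrite {}/rhs -mulr_suml.
have [q0 _ _] := parameters_bounds.
have aN0 : a t != 0 by apply/eqP => /modulus_eq0.
have a0N0 : a0 t != 0 by apply/eqP => /modulus_eq0.
set S := \sum_(j < n) b j t `^ r.
have S0 : 0 < S.
  have : \sum_(j < n) b j t != 0 by apply/eqP.
  rewrite psumr_neq0 => [/hasP[j _ /andP[_ bj0]]|j _]; last exact: modulus_ge0.
  rewrite /S (bigD1 j)//= ltr_pwDl ?powR_gt0// sumr_ge0// => i _.
  exact: powR_ge0.
case: hpqr => [[q1 qp qr]|[[q1 qr rp]|[q1 qp pr]]].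
- have [/andP[k0 k1] kE] := ktilde_PP t qp qr.
  have := extremal_value_stationary0 (a t) (modulus_ge0 (w0 t)) k0 qp a0N0.
  rewrite /v /extremal_function qp /ktilde qr => ->.
  rewrite (extremal_value_stationary (modulus_ge0 (w t)) (modulus_ge0 (w0 t))
    k0 qp qr aN0 a0N0 S0 k1).
    by rewrite -mulrDl subrKC mul1r.
  rewrite kE; congr (_ * _ `^ _); rewrite /S mulr_suml; apply: eq_bigr => j _.
  by rewrite powR_div ?modulus_ge0.
- have qp : q < p by rewrite qr.
  have := extremal_value_stationary0 (a t) (modulus_ge0 (w0 t))
    (ktilde_ge0 t qp) qp a0N0.
  rewrite /v /extremal_function qp => ->.
  (* On P1 the exponent [r - q] is 0 and v^0 = 1 even at v = 0, so the sum contributes exactly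
     [S]. *)
  rewrite qr subrr powRr0 mulr1 /ktilde ltxx /ktilde_P1 -qr.
  have aq0 : 0 < a t `^ q by rewrite powR_gt0// lt0r aN0 modulus_ge0.
  have -> : \sum_(j < n) b j t `^ q = S by rewrite /S -qr.
  rewrite powRN; split.
    rewrite -lerBlDr; apply: le_trans (_ : (1 - (a t `^ q)^-1 * S) * a t `^ q <= _).
      by rewrite mulrBl mul1r mulrAC mulVf ?gt_eqF// mul1r.
    by rewrite ler_wpM2r ?powR_ge0// le_max lexx.
  (* In the truncated case k = 0, hence v = 0 and the implication is vacuous. *)
  case: leP => [_|_ _]; last by rewrite mulrBl mul1r mulrAC mulVf ?gt_eqF// mul1r subrK.
  by rewrite extremal_value_eq0 ?eqxx.
- have rp0 : r - p != 0 by rewrite subr_eq0 gt_eqF.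
  rewrite /v /extremal_function qp ltxx subrr powRr0 mulr1.
  rewrite powRVK ?ratio_P2_ge0// /ratio_P2 -/S mulrC divfK ?(gt_eqF S0)//.
  split; first by rewrite -lerBlDl le_max lexx.
  case: leP => [_|_ _]; last by rewrite subrKC.
  by rewrite mul0r powR0 ?invr_eq0// eqxx.
Qed.

End extremal_functions.

Theorem corollary2 (R : realType) (K : scalar_kind)
    (V : lmodType R) (disp : measure_display) (T : measurableType disp)
    (iota : T -> V) (coneT : is_cone iota)
    (d : R) (mu : {measure set T -> \bar R})
    (mu_hom : homogeneous_measure iota d mu)
    (p q r : R) (hpqr : in_P p q r \/ in_P1 p q r \/ in_P2 p q r)
    (n : nat) (hn : (0 < n)%N)
    (w w0 : T -> scalar_field R K) (w_ : 'I_n -> T -> scalar_field R K)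
    (mw : scalar_measurable w) (mw0 : scalar_measurable w0)
    (mw_ : forall j, scalar_measurable (w_ j))
    (theta theta0 theta1 : R)
    (w_hom : homogeneous iota theta (fun t => modulus (w t)))
    (w0_hom : homogeneous iota theta0 (fun t => modulus (w0 t)))
    (w__hom : forall j, homogeneous iota theta1 (fun t => modulus (w_ j t)))
    (w_neq0 : {ae mu, forall t, w t <> 0 /\ w0 t <> 0})
    (sum_neq0 : {ae mu, forall t, \sum_(j < n) modulus (w_ j t) <> 0}) :
  let ttheta := theta + d / q in
  let ttheta0 := theta0 + d / p in
  let ttheta1 := theta1 + d / r in
  let gamma := (ttheta1 - ttheta) / (ttheta1 - ttheta0) in
  let I_1 := Itilde_1 mu p q r w w0 w_ in
  let I_ j := Itilde_succ mu p q r w w0 w_ j in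
  let I_2 := I_ (Ordinal hn) in
  let C := fine I_1 `^ (- gamma / p) * fine I_2 `^ (- (1 - gamma) / r) *
           (fine I_1 + n%:R * fine I_2) `^ q^-1 in
  ttheta0 <> ttheta1 ->
  (I_1 < +oo)%E ->
  (forall j, (I_ j < +oo)%E) ->
  (forall j, I_ j = I_2) ->
  (* otherwise [C] involves 0 to a negative power *)
  (0 < I_1)%E ->
  carlson_inequality mu p q r w w0 w_ gamma C /\
  (forall C' : R, carlson_inequality mu p q r w w0 w_ gamma C' -> C <= C').
Proof.
move=> ttheta ttheta0 ttheta1 gamma I_1 I_ I_2 C th01 I1_lty I_lty I_eq I1_gt0.
have [q0 qp qr] := parameters_bounds hpqr.
have I1E : I_1 = (fine I_1)%:E by rewrite fineK// ge0_fin_numE// ltW.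
have I2E : I_2 = (fine I_2)%:E.
  rewrite fineK// ge0_fin_numE; first exact: I_lty.
  rewrite /I_2 /I_ Itilde_succE//; apply: integral_ge0 => t _.
  by rewrite lee_fin powR_ge0.
have fI1_gt0 : 0 < fine I_1 by rewrite fine_gt0// I1_gt0.
have intI1 := Itilde_1E mu w w0 w_ hpqr.
have intI2 j := Itilde_succE mu w w0 w_ hpqr j.
(* From here on the three parameter sets are treated alike: they enter only through the stationarity
   of [v] and the two integral identities. *)
pose v := extremal_function p q r w w0 w_.
have stationary : {ae mu, forall t,
    let rhs := modulus (w0 t) `^ p * v t `^ (p - q) +
               \sum_(j < n) modulus (w_ j t) `^ r * v t `^ (r - q) in
    modulus (w t) `^ q <= rhs /\ (v t != 0 -> modulus (w t) `^ q = rhs)}.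
  apply: filterS2 w_neq0 sum_neq0 => t [wt w0t] bt.
  exact: extremal_function_stationary.
have w0_neq0 : {ae mu, forall t, w0 t <> 0} by apply: filterS w_neq0 => t [].
have int1 : (\int[mu]_t ((modulus (w0 t) * v t) `^ p)%:E = (fine I_1)%:E)%E.
  by rewrite -I1E -intI1.
have int2 j : (\int[mu]_t ((modulus (w_ j t) * v t) `^ r)%:E = (fine I_2)%:E)%E.
  by rewrite -I2E -intI2; exact: I_eq.
have mv : measurable_fun [set: T] v by exact: measurable_extremal_function.
have v_ge0 t : 0 <= v t by exact: extremal_function_ge0.
have th01' : ttheta0 != ttheta1 by apply/eqP.
split.
- exact: (extremal_carlson_inequality coneT mu_hom hn mw mw0 mw_ w_hom w0_hom w__hom
    w0_neq0 sum_neq0 q0 qp qr mv v_ge0 stationary fI1_gt0 int1 int2 th01').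
- exact: (extremal_carlson_sharp hn mw mw0 mw_ sum_neq0 q0 qp qr mv v_ge0
    stationary fI1_gt0 int1 int2).
Qed.
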